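(* Let $X$ be a Banach space and $H$ a Hilbert space. For every bounded operator $\phi : X \to H$, we have \[ \lim_{k \to \infty} \left\| \phi^{\otimes k} \right\|_{\varepsilon \to h}^{1/k} = \pi_2(\phi). \] In particular, the limit is finite if and only if $\phi$ is $2$-summing.
   Context: All spaces are over the same field, $\mathbf{R}$ or $\mathbf{C}$. $B_Z$ is the closed unit ball of $Z$. $\otimes$ is the algebraic tensor product. For normed spaces $X,Y$ and $z \in X \otimes Y$, the injective norm is $\|z\|_\varepsilon = \sup\{|\langle \alpha \otimes \beta, z\rangle| : \alpha \in B_{X^*}, \beta \in B_{Y^*}\}$; $X\otimes_\varepsilon Y$ is the resulting (not completed) normed space. This is associative, and $X^{\otimes_\varepsilon k}$ is defined inductively by $X^{\otimes_\varepsilon 1} = X$, $X^{\otimes_\varepsilon (k+1)} = X^{\otimes_\varepsilon k} \otimes_\varepsilon X$. For a Hilbert space $H$, $H^{\otimes_h k}$ is the algebraic tensor product $H^{\otimes k}$ with its canonical inner product. For a bounded operator $\phi : X \to H$ and $k \geq 1$, $\|\phi^{\otimes k}\|_{\varepsilon \to h}$ is the operator norm of $\phi^{\otimes k} : X^{\otimes_\varepsilon k} \to H^{\otimes_h k}$, with the convention that the norm of an unbounded operator is $+\infty$; the limit is taken in $[0,+\infty]$. For a bounded operator $\phi : X \to Y$, $\pi_2(\phi)$ (the $2$-summing norm) is the smallest $C$ such that $(\sum_i \|\phi(x_i)\|^2)^{1/2} \leq C \sup_{f \in B_{X^*}} (\sum_i |f(x_i)|^2)^{1/2}$ for every finite family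 $(x_i)$ in $X$; $\phi$ is $2$-summing if such a finite $C$ exists, and otherwise $\pi_2(\phi)=+\infty$. *)

(* Defs.v *)
From HB Require Import structures.
From mathcomp Require Import all_boot all_order all_algebra.
From mathcomp Require Import all_classical all_reals all_analysis.
From mathcomp Require Import complex.

Set Implicit Arguments.
Unset Strict Implicit.
Unset Printing Implicit Defensive.

Import Order.TTheory GRing.Theory Num.Theory.
Import numFieldNormedType.Exports.

Local Open Scope classical_set_scope.
Local Open Scope ring_scope.

(* The algebraic tensor product X (x) Y over a field is realized, as usual, as
   the span of the elementary tensors x (x) y : B |-> B x y inside the space of
   functionals on the bilinear forms on X * Y.  With this model,
   <alpha (x) beta, z> is z evaluated at the bilinear form alpha (x) beta. *)
Section Tensor.
Variables (K : fieldType) (X Y : lmodType K).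

Definition bilform := {bilinear X -> Y -> K | *%R & *%R}.

Definition elem_tensor (x : X) (y : Y) : bilform -> K^o := fun B => B x y.

Definition is_tensor : {pred bilform -> K^o} := fun z =>
  `[< exists s : seq (X * Y), z = \sum_(p <- s) elem_tensor p.1 p.2 >].

Lemma is_tensor_submod_closed : submod_closed is_tensor.
Proof.
split; first by apply/asboolP; exists [::]; rewrite big_nil.
move=> a z w /asboolP[s ->] /asboolP[t ->]; apply/asboolP.
exists ([seq (a *: p.1, p.2) | p <- s] ++ t).
rewrite big_cat big_map /= scaler_sumr; congr (_ + _).
by apply: eq_bigr => p _; apply/funext => B; rewrite /elem_tensor linearZl_LR.
Qed.

HB.instance Definition _ :=
  GRing.isSubmodClosed.Build K (bilform -> K^o) is_tensor
    is_tensor_submod_closed.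

Record tensor := Tensor {
  tensor_fun :> bilform -> K^o ;
  tensor_funP : tensor_fun \in is_tensor }.

HB.instance Definition _ := [isSub for tensor_fun].
HB.instance Definition _ := [Choice of tensor by <:].
HB.instance Definition _ := [SubChoice_isSubLmodule of tensor by <:].

End Tensor.
Arguments tensor {K} X Y.

Section TensorTheory.
Variables (K : fieldType) (X Y : lmodType K).
Implicit Types (z w : tensor X Y) (B : bilform X Y).

Lemma tensorP z :
  exists s : seq (X * Y), forall B, z B = \sum_(p <- s) B p.1 p.2.
Proof.
have /asboolP[s zE] := tensor_funP z.
by exists s => B; rewrite zE fct_sumE.
Qed.

Lemma tensor_eq z w : (forall B, z B = w B) -> z = w.
Proof. by move=> zw; apply: val_inj; apply/funext. Qed.

Lemma tensorDE z w B : (z + w) B = z B + w B. Proof. by []. Qed.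

Lemma tensorZE a z B : (a *: z) B = a * z B. Proof. by []. Qed.

End TensorTheory.

Section TensorMap.
Variables (K : fieldType) (X Y X' Y' : lmodType K).
Variables (f : {linear X -> X'}) (g : {linear Y -> Y'}).

Definition bil_comp (B : bilform X' Y') (x : X) (y : Y) : K := B (f x) (g y).

Lemma bil_comp_subproof (B : bilform X' Y') :
  bilinear_for *%R *%R (bil_comp B).
Proof.
by split=> [u' a x y|u a x y]; rewrite /bil_comp linearP ?linearPl ?linearPr.
Qed.

HB.instance Definition _ (B : bilform X' Y') :=
  bilinear_isBilinear.Build K X Y K _ _ (bil_comp B) (bil_comp_subproof B).

Lemma tensor_map_subproof (z : tensor X Y) :
  (fun B : bilform X' Y' => z (bil_comp B)) \in @is_tensor K X' Y'.
Proof.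
have [s zE] := tensorP z; apply/asboolP.
exists [seq (f p.1, g p.2) | p <- s].
by apply/funext => B; rewrite zE fct_sumE big_map.
Qed.

(* the map f (x) g, determined by x (x) y |-> f x (x) g y *)
Definition tensor_map (z : tensor X Y) : tensor X' Y' :=
  Tensor (tensor_map_subproof z).

Lemma tensor_map_linear : linear tensor_map.
Proof. by move=> a z w; exact: tensor_eq. Qed.

HB.instance Definition _ :=
  GRing.isLinear.Build K (tensor X Y) (tensor X' Y') _ tensor_map
    tensor_map_linear.

End TensorMap.

Section Functional.
Variables (K : fieldType) (X Y : lmodType K).

(* <alpha (x) beta, .> is the evaluation of tensors at this bilinear form *)
Definition tensor_dual (alpha : {scalar X}) (beta : {scalar Y}) (x : X) (y : Y)
  : K := alpha x * beta y.

Lemma tensor_dual_subproof (alpha : {scalar X}) (beta : {scalar Y}) :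
  bilinear_for *%R *%R (tensor_dual alpha beta).
Proof.
split=> [u' a x y|u a x y]; rewrite /tensor_dual linearD linearZ_LR.
  by rewrite mulrDl /= mulrA.
by rewrite mulrDr /= mulrCA.
Qed.

HB.instance Definition _ (alpha : {scalar X}) (beta : {scalar Y}) :=
  bilinear_isBilinear.Build K X Y K _ _ (tensor_dual alpha beta)
    (tensor_dual_subproof alpha beta).

End Functional.

Section TensorDot.
Variables (K : numFieldType) (conj : involutive_rmorphism K).
Variables (U V : lmodType K).
Variables (dU : {dot U for conj}) (dV : {dot V for conj}).

Let dotC (W : lmodType K) (d : {dot W for conj}) (u v : W) :
  d u v = conj (d v u).
Proof. by rewrite hermC expr0 mul1r. Qed.

(* (c, d) |-> <c, a> <d, b> *)
Definition dot_bil (a : U) (b : V) (c : U) (d : V) : K := dU c a * dV d b.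

Lemma dot_bil_subproof (a : U) (b : V) : bilinear_for *%R *%R (dot_bil a b).
Proof.
split=> [u' t x y|u t x y]; rewrite /dot_bil linearPl.
  by rewrite mulrDl /= mulrA.
by rewrite mulrDr /= mulrCA.
Qed.

HB.instance Definition _ (a : U) (b : V) :=
  bilinear_isBilinear.Build K U V K _ _ (dot_bil a b) (dot_bil_subproof a b).

(* (a, b) |-> <a (x) b, w>, the conjugate of w ((c, d) |-> <c, a> <d, b>) *)
Definition dot_with (w : tensor U V) (a : U) (b : V) : K :=
  conj (w (dot_bil a b)).

Lemma dot_withE (w : tensor U V) : exists t : seq (U * V),
  (forall B, w B = \sum_(q <- t) B q.1 q.2) /\
  (forall a b, dot_with w a b = \sum_(q <- t) dU a q.1 * dV b q.2).
Proof.
have [t wE] := tensorP w; exists t; split=> // a b.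
rewrite /dot_with wE rmorph_sum; apply: eq_bigr => q _ /=.
by rewrite /dot_bil rmorphM /= -!dotC.
Qed.

Lemma dot_with_subproof (w : tensor U V) :
  bilinear_for *%R *%R (dot_with w).
Proof.
have [t [_ wE]] := dot_withE w; split=> [b a x y|a b x y]; rewrite !wE /=.
  rewrite mulr_sumr -big_split; apply: eq_bigr => q _ /=.
  by rewrite linearDl linearZl_LR mulrDl mulrA.
rewrite mulr_sumr -big_split; apply: eq_bigr => q _ /=.
by rewrite linearDl linearZl_LR mulrDr mulrCA.
Qed.

HB.instance Definition _ (w : tensor U V) :=
  bilinear_isBilinear.Build K U V K _ _ (dot_with w) (dot_with_subproof w).

(* the inner product with <a (x) b, c (x) d> = <a, c> <b, d> *)
Definition tensor_dot (z w : tensor U V) : K := z (dot_with w).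

Lemma tensor_dotE (z w : tensor U V) (s t : seq (U * V)) :
  (forall B, z B = \sum_(p <- s) B p.1 p.2) ->
  (forall B, w B = \sum_(q <- t) B q.1 q.2) ->
  tensor_dot z w = \sum_(p <- s) \sum_(q <- t) dU p.1 q.1 * dV p.2 q.2.
Proof.
move=> zE wE; rewrite /tensor_dot zE; apply: eq_bigr => p _ /=.
rewrite /dot_with wE rmorph_sum; apply: eq_bigr => q _ /=.
by rewrite /dot_bil rmorphM /= -!dotC.
Qed.

Lemma tensor_dotC (z w : tensor U V) :
  tensor_dot z w = (-1) ^+ false * conj (tensor_dot w z).
Proof.
have [s zE] := tensorP z; have [t wE] := tensorP w.
rewrite (tensor_dotE zE wE) (tensor_dotE wE zE) mul1r rmorph_sum exchange_big.
apply: eq_bigr => q _; rewrite rmorph_sum; apply: eq_bigr => p _.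
by rewrite rmorphM /= -!dotC.
Qed.

Lemma tensor_dot_subproof : bilinear_for *%R (conj \; *%R) tensor_dot.
Proof.
split=> [w a x y //|z a x y].
by rewrite ![tensor_dot z _]tensor_dotC !mul1r rmorphD rmorphM.
Qed.

HB.instance Definition _ :=
  bilinear_isBilinear.Build K (tensor U V) (tensor U V) K _ _ tensor_dot
    tensor_dot_subproof.

HB.instance Definition _ :=
  isHermitianSesquilinear.Build K (tensor U V) false conj tensor_dot
    tensor_dotC.

Let dot_ge0 (W : lmodType K) (d : {dot W for conj}) (u : W) : 0 <= d u u.
Proof.
by have [->|/(neq0_dnorm_gt0 (s := d))/ltW//] := eqVneq u 0; rewrite linear0l.
Qed.

Let dot_eq0 (W : lmodType K) (d : {dot W for conj}) (u : W) :
  d u u = 0 -> u = 0.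
Proof.
by move=> du0; apply/eqP/negPn/negP => /(neq0_dnorm_gt0 (s := d));
  rewrite du0 ltxx.
Qed.

Let orth (p q : U * V) := dU p.1 q.1 == 0.

Let orthC p q : orth p q -> orth q p.
Proof. by rewrite /orth (dotC dU q.1) => /eqP->; rewrite rmorph0. Qed.

Lemma gram_schmidt (s : seq (U * V)) : exists t : seq (U * V),
  pairwise orth t /\
  (forall B : bilform U V,
    \sum_(p <- s) B p.1 p.2 = \sum_(q <- t) B q.1 q.2).
Proof.
elim: s => [|[x y] s [t [to st]]]; first by exists [::].
pose c e := dU x e / dU e e.
pose x' := x - \sum_(q <- t) c q.1 *: q.1.
exists ((x', y) :: [seq (q.1, q.2 + c q.1 *: y) | q <- t]); split=> [|B].
  rewrite /= pairwise_map all_map; apply/andP; split; last exact: to.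
  apply/allP => q qt; rewrite /orth /= /x' linearBl linear_sumlz /=.
  suff -> : \sum_(r <- t) dU (c r.1 *: r.1) q.1 = dU x q.1 by rewrite subrr.
  elim: t {st x'} to qt => [|r t IH]//= /andP[/allP rt to].
  rewrite big_cons linearZl_LR inE => /predU1P[->|qt]; last first.
    by rewrite IH//= (eqP (rt _ qt)) mulr0 add0r.
  rewrite big_seq big1 => [|r' /rt/orthC/eqP r'0]; last first.
    by rewrite linearZl_LR /= r'0 mulr0.
  rewrite addr0 /c; have [r0|r0] := eqVneq r.1 0.
    by rewrite r0 linear0l linear0r /= !mul0r.
  by rewrite divfK// gt_eqF// neq0_dnorm_gt0.
rewrite !big_cons big_map /= st /x' linearBl linear_sumlz -addrA; congr (_ + _).
rewrite addrC -sumrB; apply: eq_bigr => q _ /=.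
by rewrite linearDr linearZl_LR linearZr_LR addrK.
Qed.

Lemma tensor_dot_gt0 (z : tensor U V) : z != 0 -> 0 < tensor_dot z z.
Proof.
have [s zs] := tensorP z; have [t [to st]] := gram_schmidt s.
have zE B : z B = \sum_(q <- t) B q.1 q.2 by rewrite zs st.
have -> : tensor_dot z z = \sum_(q <- t) dU q.1 q.1 * dV q.2 q.2.
  rewrite (tensor_dotE zE zE); elim: t to {st zE} => [|r t IH]/=.
    by rewrite !big_nil.
  move=> /andP[/allP rt /IH{}IH]; rewrite !big_cons -IH -addrA; congr (_ + _).
  rewrite big_seq big1 ?add0r => [|q /rt/eqP ->]; last by rewrite mul0r.
  rewrite big_seq [RHS]big_seq; apply: eq_bigr => q /rt/orthC/eqP qr.
  by rewrite big_cons qr mul0r add0r.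
move=> z0; rewrite lt_def sumr_ge0 ?andbT => [|q _]; last exact: mulr_ge0.
apply: contra z0; rewrite psumr_eq0 => [/allP t0|q _]; last exact: mulr_ge0.
apply/eqP/tensor_eq => B; rewrite zE big_seq big1// => q /t0.
by rewrite mulf_eq0 => /orP[] /eqP/dot_eq0 ->; rewrite ?linear0l ?linear0r.
Qed.

HB.instance Definition _ :=
  isDotProduct.Build K (tensor U V) tensor_dot tensor_dot_gt0.

End TensorDot.

(* tensor_pow X n is the power of order n + 1, i.e. tensor_pow X 0 = X *)
Fixpoint tensor_pow (K : fieldType) (X : lmodType K) (n : nat) : lmodType K :=
  if n is m.+1 then tensor (tensor_pow X m) X else X.

Fixpoint tensor_pow_map (K : fieldType) (X Y : lmodType K)
    (f : {linear X -> Y}) (n : nat) :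
    {linear tensor_pow X n -> tensor_pow Y n} :=
  match n return {linear tensor_pow X n -> tensor_pow Y n} with
  | 0 => f
  | m.+1 => tensor_map (tensor_pow_map f m) f
  end.

Fixpoint tensor_pow_dot (K : numFieldType) (conj : involutive_rmorphism K)
    (U : lmodType K) (d : {dot U for conj}) (n : nat) :
    {dot tensor_pow U n for conj} :=
  match n return {dot tensor_pow U n for conj} with
  | 0 => d
  | m.+1 => tensor_dot (tensor_pow_dot d m) d
  end.

Variant scalar_kind := RealScalars | ComplexScalars.

Definition scalars (R : realType) (F : scalar_kind) : numFieldType :=
  match F with
  | RealScalars => R
  | ComplexScalars => R[i]
  end.

Definition scalar_re (R : realType) (F : scalar_kind) : scalars R F -> R :=
  match F with
  | RealScalars => idfun
  | ComplexScalars => @complex.Re R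
  end.

Definition scalar_conj (R : realType) (F : scalar_kind) :
    involutive_rmorphism (scalars R F) :=
  match F with
  | RealScalars => idfun
  | ComplexScalars => Num.conj
  end.

Section Norms.
Variables (R : realType) (F : scalar_kind).
Local Notation K := (scalars R F).

(* In mathcomp norms take values in the scalar field; these are the
   corresponding elements of R. *)
Definition modulus (a : K) : R := scalar_re `|a|.
Definition norm (V : normedModType K) (x : V) : R := scalar_re `|x|.

(* B_{V^*} for the norm N on V *)
Definition dual_ball (V : lmodType K) (N : V -> R) : set {scalar V} :=
  [set f | forall x, modulus (f x) <= N x].

(* The set is bounded above by \sum_i NX x_i * NY y_i if z is the sum of the
   x_i (x) y_i, so sup is the actual supremum. *)
Definition inj_norm (X Y : lmodType K) (NX : X -> R) (NY : Y -> R)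
    (z : tensor X Y) : R :=
  sup [set modulus (z (tensor_dual alpha beta)) |
       alpha in dual_ball NX & beta in dual_ball NY].

Fixpoint inj_norm_pow (X : lmodType K) (N : X -> R) (n : nat) :
    tensor_pow X n -> R :=
  match n return tensor_pow X n -> R with
  | 0 => N
  | m.+1 => inj_norm (@inj_norm_pow X N m) N
  end.

Definition dot_norm (U : lmodType K) (d : {dot U for scalar_conj R F}) (x : U)
  : R := Num.sqrt (scalar_re (d x x)).

Definition op_norm (V W : lmodType K) (NV : V -> R) (NW : W -> R)
    (T : V -> W) : \bar R :=
  ereal_sup [set (NW (T x))%:E | x in [set x | NV x <= 1]].

Definition bounded_operator (X Y : normedModType K) (phi : X -> Y) :=
  exists M : R, forall x, norm (phi x) <= M * norm x.

Definition summing2_bound (X Y : normedModType K) (phi : X -> Y) (C : R) :=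
  0 <= C /\ forall s : seq X,
    Num.sqrt (\sum_(x <- s) norm (phi x) ^+ 2) <=
    C * sup [set Num.sqrt (\sum_(x <- s) modulus (f x) ^+ 2) |
             f in dual_ball (@norm X)].

Definition two_summing (X Y : normedModType K) (phi : X -> Y) :=
  exists C, summing2_bound phi C.

Definition pi2 (X Y : normedModType K) (phi : X -> Y) : \bar R :=
  ereal_inf [set C%:E | C in summing2_bound phi].

End Norms.

Arguments norm {R F V} x.
Arguments inj_norm_pow {R F X} N n _.
Arguments pi2 {R F X Y} phi.
Arguments two_summing {R F X Y} phi.
Arguments bounded_operator {R F X Y} phi.

(* Main.v *)
Require Import Defs.
From HB Require Import structures.
From mathcomp Require Import all_boot all_order all_algebra.
From mathcomp Require Import all_classical all_reals all_analysis.
From mathcomp Require Import complex ring lra.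

Import Order.TTheory GRing.Theory Num.Theory.
Import numFieldNormedType.Exports.
Local Open Scope classical_set_scope.
Local Open Scope ring_scope.

Set Implicit Arguments.
Unset Strict Implicit.
Unset Printing Implicit Defensive.

(** Let [C] be admissible in the definition of [pi2 phi]. An induction on the
    tensor power ([tensor_map_summing2], [tensor_pow_map_summing2]) bounds the
    operator norm of the [k]-th power of [phi] by [C ^+ k]: after
    orthogonalizing the image of the first [k - 1] factors, the norm of the
    image of a tensor is a sum of squares [|phi w_j|^2], to which the 2-summing
    inequality applies. Hence every term of the sequence is at most [pi2 phi].

    Conversely, let [0 <= r < pi2 phi]. There are finitely many [x_i] in [X] with
    [sum_i |f x_i|^2 <= 1] for all [f] in the dual ball, and with [S = sum_i
    |phi x_i|^2 > r^2] ([not_summing2_bound]). Consider the tensors [sum +-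
    x_i1 (x) ... (x) x_ik] with independent random signs. The image of such a
    tensor has mean squared norm [S^k], because independent signs make the
    summands orthogonal in mean. Its injective norm, on the other hand, is at
    most [(1 - e)^-k] times the maximum of its values at [k]-fold products of
    points of a finite [e]-net of the Euclidean ball, up to a constant
    ([inj_norm_pow_le]). There are only exponentially many such products, and
    each value is a subgaussian signed sum, so that their maximum can be kept
    below a multiple of [k]; the lemma [exists_signs] finds signs for which
    this holds while the image stays long. Hence the [k]-th operator norm is at
    least [((1 - e) sqrt S)^k] up to a factor linear in [k], so for small [e]
    it is eventually at least [r^k] ([op_norm_tensor_pow_ge]). *)

(** * Real and complex scalars, uniformly *)

Section Scalars.
Variables (R : realType) (F : scalar_kind).
Local Notation K := (scalars R F).
Local Notation re := (@scalar_re R F).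
Local Notation mod := (@modulus R F).
Local Notation cj := (scalar_conj R F).

Definition scalar_of : R -> K :=
  match F return R -> scalars R F with
  | RealScalars => idfun
  | ComplexScalars => real_complex R
  end.

(** Zero for real scalars, so that [modulus_sqr] and the estimates of complex
    sums through real and imaginary parts hold for both kinds of scalars. *)
Definition scalar_im : K -> R :=
  match F return scalars R F -> R with
  | RealScalars => fun=> 0
  | ComplexScalars => @complex.Im R
  end.

Lemma scalar_reD : {morph re : a b / a + b}.
Proof. by rewrite /scalar_re; case: F => //= -[? ?] [? ?]. Qed.

Lemma scalar_imD : {morph scalar_im : a b / a + b}.
Proof.
by rewrite /scalar_im; case: F => //= [a b|[? ?] [? ?]]; rewrite ?addr0.
Qed.

Lemma scalar_re0 : re 0 = 0. Proof. by rewrite /scalar_re; case: F. Qed.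
Lemma scalar_im0 : scalar_im 0 = 0. Proof. by rewrite /scalar_im; case: F. Qed.

Lemma scalar_reZ t a : re (scalar_of t * a) = t * re a.
Proof.
rewrite /scalar_re/scalar_of; case: F a => //= -[? ?] /=.
by rewrite mul0r subr0.
Qed.

Lemma scalar_imZ t a : scalar_im (scalar_of t * a) = t * scalar_im a.
Proof.
by rewrite /scalar_im/scalar_of; case: F a => //= [_|[? ?]] /=;
  rewrite ?mulr0// mul0r addr0.
Qed.

Lemma scalar_of_re a : 0 <= a -> a = scalar_of (re a).
Proof.
rewrite /scalar_re/scalar_of; case: F a => /= [a _|[x y]] //.
by rewrite lecE /= => /andP[/eqP->].
Qed.

Lemma scalar_ofK t : re (scalar_of t) = t.
Proof. by rewrite /scalar_re/scalar_of; case: F. Qed.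

Lemma scalar_ofM : {morph scalar_of : s t / s * t}.
Proof. by rewrite /scalar_of; case: F => //= s t; rewrite rmorphM. Qed.

Lemma scalar_of1 : scalar_of 1 = 1.
Proof. by rewrite /scalar_of; case: F. Qed.

Lemma conj_scalar_of t : cj (scalar_of t) = scalar_of t.
Proof.
by rewrite /scalar_conj/scalar_of; case: F => //=; exact: conjc_real.
Qed.

Lemma mulr_conj a : a * cj a = scalar_of (mod a ^+ 2).
Proof.
rewrite /modulus /scalar_conj /scalar_re /scalar_of; case: F a => /= [a|[x y]].
  by rewrite real_normK ?num_real// expr2.
rewrite sqr_sqrtr ?addr_ge0 ?sqr_ge0//.
by apply/eqP; rewrite eq_complex /=; apply/andP; split; apply/eqP; ring.
Qed.

Lemma re_conj a : re (cj a) = re a.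
Proof. by rewrite /scalar_conj/scalar_re; case: F a => //= -[]. Qed.

Lemma modulus_normE a : `|a| = scalar_of (mod a).
Proof. by rewrite /modulus -scalar_of_re. Qed.

Lemma modulus_sqr a : mod a ^+ 2 = re a ^+ 2 + scalar_im a ^+ 2.
Proof.
rewrite /modulus /scalar_im /scalar_re; case: F a => /= [a|[x y]].
  by rewrite real_normK ?num_real// expr0n addr0.
by rewrite sqr_sqrtr ?addr_ge0 ?sqr_ge0.
Qed.

Lemma modulus_ge0 a : 0 <= mod a.
Proof.
rewrite /modulus /scalar_re; case: F a => //= -[x y].
by rewrite sqrtr_ge0.
Qed.

Lemma modulus_le (a : K) (t : R) : 0 <= t ->
  (modulus a <= t) = (scalar_re a ^+ 2 + scalar_im a ^+ 2 <= t ^+ 2).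
Proof. by move=> t0; rewrite -modulus_sqr ler_pXn2r ?nnegrE ?modulus_ge0. Qed.

Lemma modulusM a b : mod (a * b) = mod a * mod b.
Proof.
by rewrite /modulus normrM [`|a|]modulus_normE scalar_reZ scalar_ofK.
Qed.

Lemma scalar_re_le a b : a <= b -> re a <= re b.
Proof.
rewrite /scalar_re; case: F a b => //= -[x y] [z t].
by rewrite lecE => /andP[].
Qed.

Lemma modulusD a b : mod (a + b) <= mod a + mod b.
Proof. by rewrite /modulus -scalar_reD scalar_re_le// ler_normD. Qed.

Lemma modulus0 : mod 0 = 0.
Proof. by rewrite /modulus normr0 scalar_re0. Qed.

Lemma modulus_of t : 0 <= t -> mod (scalar_of t) = t.
Proof.
rewrite /modulus /scalar_of /scalar_re; case: F => /= t0.
  by rewrite ger0_norm.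
by rewrite expr0n addr0 sqrtr_sqr ger0_norm.
Qed.

Lemma modulus_sum (I : Type) (s : seq I) (P : pred I) (f : I -> K) :
  mod (\sum_(i <- s | P i) f i) <= \sum_(i <- s | P i) mod (f i).
Proof.
elim/big_rec2: _ => [|i x y _ le_yx]; first by rewrite modulus0.
by rewrite (le_trans (modulusD _ _))// lerD.
Qed.

Lemma scalar_re_sum (I : Type) (s : seq I) (P : pred I) (f : I -> K) :
  re (\sum_(i <- s | P i) f i) = \sum_(i <- s | P i) re (f i).
Proof. exact: (big_morph re scalar_reD scalar_re0). Qed.

Lemma scalar_im_sum (I : Type) (s : seq I) (P : pred I) (f : I -> K) :
  scalar_im (\sum_(i <- s | P i) f i) = \sum_(i <- s | P i) scalar_im (f i).
Proof. exact: (big_morph _ scalar_imD scalar_im0). Qed.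

Lemma norm_ge0 (V : normedModType K) (x : V) : 0 <= norm x.
Proof. by rewrite /norm -scalar_re0 scalar_re_le. Qed.

Lemma normZ (V : normedModType K) a (x : V) : norm (a *: x) = mod a * norm x.
Proof. by rewrite /norm normrZ [`|a|]modulus_normE scalar_reZ. Qed.

Lemma norm_sum (V : normedModType K) (I : Type) (s : seq I) (f : I -> V) :
  norm (\sum_(i <- s) f i) <= \sum_(i <- s) norm (f i).
Proof. by rewrite /norm -scalar_re_sum scalar_re_le// ler_norm_sum. Qed.

End Scalars.
Arguments scalar_of {R} F t.

(** * The injective norm and its dual ball *)

Section InjectiveNorm.
Variables (R : realType) (F : scalar_kind).
Local Notation K := (scalars R F).
Variables (X Y : lmodType K).

(** A copy of the application of a tensor to a bilinear form, which can carry
    the structure of a linear functional on the tensor product. *)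
Definition tensor_eval (B : bilform X Y) (z : tensor X Y) : K := z B.

Lemma tensor_eval_linear B : linear_for *%R (tensor_eval B).
Proof. by []. Qed.

HB.instance Definition _ B :=
  GRing.isLinear.Build K (tensor X Y) K *%R (tensor_eval B)
    (tensor_eval_linear B).

Variables (NX : X -> R) (NY : Y -> R).

Lemma inj_norm_ub (z : tensor X Y) (alpha : {scalar X}) (beta : {scalar Y}) :
  dual_ball NX alpha -> dual_ball NY beta ->
  modulus (z (tensor_dual alpha beta)) <= inj_norm NX NY z.
Proof.
move=> al be; apply: ub_le_sup; last by exists alpha => //; exists beta.
have [s zE] := tensorP z.
exists (\sum_(p <- s) NX p.1 * NY p.2) => _ [a al' [b be' <-]].
rewrite zE (le_trans (modulus_sum _ _ _))// ler_sum// => p _.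
by rewrite modulusM ler_pM ?modulus_ge0.
Qed.

Lemma inj_norm_le (z : tensor X Y) (M : R) : 0 <= M ->
  (forall alpha beta, dual_ball NX alpha -> dual_ball NY beta ->
    modulus (z (tensor_dual alpha beta)) <= M) ->
  inj_norm NX NY z <= M.
Proof.
move=> M0 zM; rewrite /inj_norm; set A := (X in sup X).
have [[r Ar]|A0] := pselect (A !=set0).
  by apply: ge_sup; [exists r|move=> _ [a al [b be <-]]; exact: zM].
rewrite (_ : A = set0) ?sup0//; apply/seteqP; split=> // r Ar.
by case: A0; exists r.
Qed.

(** Hypotheses on all functionals in the dual ball of a tensor power can be
    tested on product functionals, which is the form that inductions over the
    power need. *)
Lemma tensor_eval_dual_ball (alpha : {scalar X}) (beta : {scalar Y}) :
  dual_ball NX alpha -> dual_ball NY beta ->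
  dual_ball (inj_norm NX NY) (tensor_eval (tensor_dual alpha beta)).
Proof. by move=> al be z; exact: inj_norm_ub. Qed.

End InjectiveNorm.

(** * Inner products with values in the scalars *)

Section DotProduct.
Variables (R : realType) (F : scalar_kind).
Local Notation K := (scalars R F).
Variables (U : lmodType K) (d : {dot U for scalar_conj R F}).

Lemma dotC u v : d u v = scalar_conj R F (d v u).
Proof. by rewrite hermC expr0 mul1r. Qed.

Lemma dot_ge0 u : 0 <= d u u.
Proof.
by have [->|/(neq0_dnorm_gt0 (s := d))/ltW//] := eqVneq u 0; rewrite linear0l.
Qed.

Lemma dot_normE u : d u u = scalar_of F (dot_norm d u ^+ 2).
Proof.
have u0 := dot_ge0 u; rewrite /dot_norm sqr_sqrtr -?scalar_of_re//.
by rewrite -(scalar_re0 R F) scalar_re_le.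
Qed.

Lemma dot_norm_ge0 u : 0 <= dot_norm d u. Proof. exact: sqrtr_ge0. Qed.

Lemma sqr_dot_norm u : dot_norm d u ^+ 2 = scalar_re (d u u).
Proof. by rewrite dot_normE scalar_ofK. Qed.

Definition dot_by (w u : U) : K := d u w.

Lemma dot_by_linear w : linear_for *%R (dot_by w).
Proof. by move=> a u v; rewrite /dot_by linearPl. Qed.

HB.instance Definition _ w :=
  GRing.isLinear.Build K U K *%R (dot_by w) (dot_by_linear w).

(** Only the diagonal of a Gram matrix survives when the left components of the
    tensors are orthogonal; [G] stands for the contribution of the right
    components. *)
Lemma orthogonal_sum (A : Type) (G : U * A -> U * A -> K) (t : seq (U * A)) :
  pairwise (fun p q => d p.1 q.1 == 0) t ->
  \sum_(p <- t) \sum_(q <- t) d p.1 q.1 * G p q =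
  \sum_(p <- t) d p.1 p.1 * G p p.
Proof.
elim: t => [|r t IH]/=; first by rewrite !big_nil.
move=> /andP[rt /IH{}IH]; rewrite !big_cons -IH -addrA; congr (_ + _).
have rt0 q : q \in map fst t -> d r.1 q = 0.
  by move: rt; rewrite -(all_map fst (fun q => d r.1 q == 0)) => /allP rt /rt/eqP.
have big0 (H : U * A -> K) (t' : seq (U * A)) :
    (forall q, q \in map fst t' -> d r.1 q = 0) ->
    \sum_(q <- t') d r.1 q.1 * H q = 0 /\ \sum_(q <- t') d q.1 r.1 * H q = 0.
  elim: t' => [|q t' IHt] t'0; rewrite ?big_nil// !big_cons.
  have [|-> ->] := IHt; first by move=> x xt; apply: t'0; rewrite inE xt orbT.
  by rewrite [d q.1 _]dotC t'0 ?inE ?eqxx// rmorph0 !mul0r !addr0.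
rewrite (big0 _ t rt0).1 add0r.
under eq_bigr do rewrite big_cons.
by rewrite big_split/= (big0 _ t rt0).2 add0r.
Qed.

End DotProduct.

(** * The 2-summing norm bounds every tensor power *)

Section UpperBound.
Variables (R : realType) (F : scalar_kind).
Local Notation K := (scalars R F).
Variables (X H : normedModType K) (dotH : {dot H for scalar_conj R F}).
Hypothesis normH : forall x : H, `|x| ^+ 2 = dotH x x.
Variables (phi : {linear X -> H}) (C : R) (phiC : summing2_bound phi C).

Lemma dot_norm_norm (h : H) : dot_norm dotH h = norm h.
Proof.
apply: (pexpIrn (n := 2)) => //; rewrite ?nnegrE ?sqrtr_ge0 ?norm_ge0//.
rewrite sqr_dot_norm -normH /norm (@scalar_of_re R F `|h|)//.
by rewrite expr2 -scalar_ofM !scalar_ofK.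
Qed.

Lemma summing2_le (s : seq X) (M : R) : 0 <= M ->
  (forall f : {scalar X}, dual_ball (@norm R F X) f ->
    \sum_(x <- s) modulus (f x) ^+ 2 <= M ^+ 2) ->
  \sum_(x <- s) norm (phi x) ^+ 2 <= (C * M) ^+ 2.
Proof.
case: phiC => C0 /(_ s) hs M0 fM.
have S0 : 0 <= \sum_(x <- s) norm (phi x) ^+ 2.
  by apply: sumr_ge0 => *; exact: sqr_ge0.
rewrite -(sqr_sqrtr S0) lerXn2r ?nnegrE ?sqrtr_ge0 ?mulr_ge0//.
rewrite (le_trans hs)// ler_wpM2l//; apply: ge_sup.
  exists (Num.sqrt (\sum_(x <- s) modulus ((\0 : {scalar X}) x) ^+ 2)).
  by exists (\0 : {scalar X}) => // x; rewrite /= modulus0 norm_ge0.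
move=> _ [f fb <-]; rewrite -(ger0_norm M0) -sqrtr_sqr.
by rewrite ler_sqrt ?sqr_ge0// fM.
Qed.

(** The inductive step. Write [z] as the sum of the [v_i (x) x_i].
    Orthogonalizing the vectors [T v_i] turns [(T (x) phi) z] into a sum of
    [u_j (x) phi y_j] with orthogonal [u_j], so its squared norm is the sum of
    the [|phi (|u_j| y_j)|^2]. The 2-summing inequality compares it with the
    supremum over [f] of the sum of the [|u_j|^2 |f y_j|^2], which by
    orthogonality is the squared norm of [T (sum_i f(x_i) v_i)].

    The bound on [T] is stated with the seminorm that the functionals of the
    dual ball of [NV] induce on [V], rather than with [NV] itself: for [T =
    phi] this is what the 2-summing inequality gives, and it starts the
    induction. *)
Section Step.
Variables (V U : lmodType K) (dU : {dot U for scalar_conj R F}).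
Variables (NV : V -> R) (T : {linear V -> U}) (D : R).
Hypothesis D0 : 0 <= D.
Hypothesis TD : forall v M, 0 <= M ->
  (forall g : {scalar V}, dual_ball NV g -> modulus (g v) <= M) ->
  dot_norm dU (T v) <= D * M.

Lemma tensor_map_summing2 (z : tensor V X) (M : R) : 0 <= M ->
  (forall alpha beta, dual_ball NV alpha -> dual_ball (@norm R F X) beta ->
    modulus (z (tensor_dual alpha beta)) <= M) ->
  dot_norm (tensor_dot dU dotH) (tensor_map T phi z) <= C * (D * M).
Proof.
move=> M0 zM; have [s zE] := tensorP z.
have [t [to st]] := gram_schmidt dU [seq (T p.1, p.2) | p <- s].
have wE B : tensor_map T phi z B =
    \sum_(q <- [seq (q.1, phi q.2) | q <- t]) B q.1 q.2.
  rewrite big_map /= zE; have := st (bil_comp idfun phi B).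
  by rewrite big_map.
have C0 : 0 <= C by case: phiC.
(* [c q *: y] absorbs the norm of the left component into the right one. *)
pose c (q : U * X) := dot_norm dU q.1.
have := @summing2_le [seq scalar_of F (c q) *: q.2 | q <- t] (D * M).
rewrite !big_map => /(_ (mulr_ge0 D0 M0)) hs.
apply: (@le_trans _ _ (Num.sqrt ((C * (D * M)) ^+ 2))); last first.
  by rewrite sqrtr_sqr ger0_norm// !mulr_ge0.
rewrite /dot_norm ler_wsqrtr//; move: hs.
rewrite [X in scalar_re X](tensor_dotE dU dotH wE wE :
  tensor_dot dU dotH (tensor_map T phi z) (tensor_map T phi z) = _) big_map.
under [X in scalar_re X]eq_bigr do rewrite big_map.
rewrite (orthogonal_sum (fun p q => dotH (phi p.2) (phi q.2)) to).
rewrite scalar_re_sum.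
under [X in _ -> X <= _]eq_bigr => q _.
  rewrite dot_normE scalar_reZ -sqr_dot_norm dot_norm_norm -exprMn.
  rewrite -(@modulus_of _ F (dot_norm dU q.1)) ?dot_norm_ge0// -normZ -linearZ.
  over.
apply=> f fb; rewrite big_map.
pose v := \sum_(p <- s) f p.2 *: p.1.
have -> : \sum_(q <- t) modulus (f (scalar_of F (c q) *: q.2)) ^+ 2 =
    dot_norm dU (T v) ^+ 2; last first.
  rewrite lerXn2r ?nnegrE ?dot_norm_ge0 ?mulr_ge0// TD// => g gb.
  rewrite /v linear_sum (_ : \sum_(_ <- _) _ = z (tensor_dual g f)) ?zM//.
  by rewrite zE; apply: eq_bigr => p _; rewrite linearZ_LR /= /tensor_dual mulrC.
(* The vectors [p] and [T v] agree because contracting the second factor with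
   [f] does not depend on the representation of a tensor. *)
pose p := \sum_(q <- t) f q.2 *: q.1.
have pT u : dU p u = dU (T v) u.
  have := st (tensor_dual (dot_by dU u) f); rewrite big_map /= /tensor_dual /dot_by.
  rewrite /p /v linear_sum !linear_sumlz /=.
  under eq_bigr do rewrite mulrC -linearZl_LR -linearZ.
  by move=> ->; apply: eq_bigr => q _; rewrite mulrC -linearZl_LR.
have -> : dot_norm dU (T v) ^+ 2 = scalar_re (dU p p).
  by rewrite sqr_dot_norm pT [in RHS]dotC pT re_conj.
have -> : dU p p = \sum_(q <- t) \sum_(r <- t)
    dU q.1 r.1 * (f q.2 * scalar_conj R F (f r.2)).
  rewrite {1}/p linear_sumlz; apply: eq_bigr => q _.
  rewrite /p linear_sumr; apply: eq_bigr => r _.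
  rewrite linearZl_LR /= linearZr_LR /=.
  by rewrite mulrA mulrC.
rewrite (orthogonal_sum (fun q r => f q.2 * scalar_conj R F (f r.2)) to).
rewrite scalar_re_sum; apply: eq_bigr => q _.
rewrite dot_normE mulr_conj -scalar_ofM scalar_ofK linearZ_LR modulusM.
by rewrite modulus_of ?dot_norm_ge0// exprMn.
Qed.
End Step.

Lemma tensor_pow_map_summing2 n z M : 0 <= M ->
  (forall g : {scalar tensor_pow X n}, dual_ball (inj_norm_pow norm n) g ->
    modulus (g z) <= M) ->
  dot_norm (tensor_pow_dot dotH n) (tensor_pow_map phi n z) <= C ^+ n.+1 * M.
Proof.
have C0 : 0 <= C by case: phiC.
elim: n z M => [z M M0 zM|n IH z M M0 zM] /=.
  have := @summing2_le [:: z] M M0; rewrite !big_seq1 dot_norm_norm expr1 => h.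
  rewrite -(@ler_pXn2r _ 2)// ?nnegrE ?norm_ge0 ?mulr_ge0//; apply: h => f fb.
  by rewrite big_seq1 lerXn2r ?nnegrE ?modulus_ge0// zM.
rewrite exprS -mulrA.
apply: (tensor_map_summing2 (exprn_ge0 _ C0) IH M0) => a b ha hb.
exact: (zM _ (tensor_eval_dual_ball ha hb)).
Qed.

Lemma op_norm_tensor_pow_le n :
  (op_norm (inj_norm_pow norm n) (dot_norm (tensor_pow_dot dotH n))
     (tensor_pow_map phi n) <= (C ^+ n.+1)%:E)%E.
Proof.
apply: ge_ereal_sup => _ [z zle <-]; rewrite lee_fin -[leRHS]mulr1.
by apply: tensor_pow_map_summing2 => // g gb; exact: le_trans (gb z) zle.
Qed.

End UpperBound.

(** * Finite nets in the Euclidean unit ball *)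

Section Nets.
Variables (R : realType) (F : scalar_kind).
Local Notation K := (scalars R F).

Lemma real_net (e : R) : 0 < e -> exists (G : finType) (g : G -> R),
  forall b, `|b| <= 1 -> exists t, `|g t| <= `|b| /\ `|b - g t| <= e.
Proof.
move=> e0; pose m := (Num.truncn e^-1).+1.
have m0 : 0 < m%:R :> R by rewrite ltr0n.
have me : m%:R^-1 <= e.
  by rewrite -[leRHS]invrK lef_pV2 ?posrE ?invr_gt0// ltW// truncnS_gt.
exists (bool * 'I_m.+1)%type.
exists (fun t : bool * 'I_m.+1 => (-1) ^+ t.1 * (t.2%:R / m%:R)) => b b1.
have bm0 : 0 <= `|b| * m%:R by rewrite mulr_ge0.
pose l := Num.truncn (`|b| * m%:R).
have lm : (l < m.+1)%N.
  rewrite ltnS truncn_le_nat (le_lt_trans (y := m%:R)) ?ltr_nat//.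
  by rewrite ler_piMl// ltW.
have /andP[lb bl] := truncn_itv bm0; rewrite -/l in lb bl.
exists (b < 0, Ordinal lm) => /=.
have lb' : l%:R / m%:R <= `|b| by rewrite ler_pdivrMr.
have lb0 : 0 <= l%:R / m%:R :> R by rewrite divr_ge0.
split; first by rewrite normrM normr_sign mul1r ger0_norm.
rewrite [X in `|X - _|]numEsign -mulrBr normrM normr_sign mul1r.
rewrite ger0_norm ?subr_ge0//.
rewrite (le_trans _ me)// lerBlDr -[X in X + _]mul1r -mulrDl ler_pdivlMr//.
by rewrite nat1r ltW.
Qed.

(** Rounding towards [0] keeps the approximant in every ball centred at [0]
    that contains the scalar. *)
Lemma scalar_net (e : R) : 0 < e -> exists (G : finType) (g : G -> K),
  forall b, modulus b <= 1 ->
  exists t, modulus (g t) <= modulus b /\ modulus (b - g t) <= e.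
Proof.
rewrite /modulus /scalar_re; case: F => /= e0; first exact: real_net.
have [|G [g gP]] := @real_net (e / 2); first by rewrite divr_gt0.
exists (G * G)%type, (fun t => Complex (g t.1) (g t.2)) => -[x y].
rewrite /= -[X in _ <= X -> _](sqrtr1 R) ler_sqrt ?addr_ge0 ?sqr_ge0// => xy.
have [|t [tx txe]] := gP x.
  by rewrite -(@ler_pXn2r _ 2) ?nnegrE// real_normK ?num_real// expr1n; nra.
have [|s [sy sye]] := gP y.
  by rewrite -(@ler_pXn2r _ 2) ?nnegrE// real_normK ?num_real// expr1n; nra.
exists (t, s) => /=; split.
  rewrite ler_sqrt ?addr_ge0 ?sqr_ge0// lerD//.
    rewrite -[leLHS]real_normK ?num_real// -[leRHS]real_normK ?num_real//.
    by rewrite lerXn2r ?nnegrE.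
  rewrite -[leLHS]real_normK ?num_real// -[leRHS]real_normK ?num_real//.
  by rewrite lerXn2r ?nnegrE.
rewrite -(ger0_norm (ltW e0)) -sqrtr_sqr ler_sqrt ?sqr_ge0//.
rewrite -real_normK ?num_real// -[X in _ + X]real_normK ?num_real//.
have := normr_ge0 (x - g t); have := normr_ge0 (y - g s); nra.
Qed.

Lemma modulus_coord_le1 (I : finType) (b : I -> K) (i : I) :
  \sum_i modulus (b i) ^+ 2 <= 1 -> modulus (b i) <= 1.
Proof.
move=> b1; rewrite -(@ler_pXn2r _ 2)// ?nnegrE ?modulus_ge0// expr1n.
rewrite (le_trans _ b1)// (bigD1 i)//= lerDl sumr_ge0// => *.
by rewrite sqr_ge0.
Qed.

Definition ball_net (I J : finType) (a : J -> I -> K) (e : R) :=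
  (forall j, \sum_i modulus (a j i) ^+ 2 <= 1) /\
  forall b : I -> K, \sum_i modulus (b i) ^+ 2 <= 1 ->
    exists j, \sum_i modulus (b i - a j i) ^+ 2 <= e ^+ 2.

(** A grid in each coordinate, fine enough for the [#|I|] coordinate errors to
    add up to less than [e ^+ 2]; grid points outside the ball are replaced by
    [0]. *)
Lemma ball_net_exists (I : finType) (e : R) : 0 < e ->
  exists (J : finType) (a : J -> I -> K), ball_net a e.
Proof.
move=> e0; pose d := e / #|I|.+1%:R.
have d0 : 0 < d by rewrite divr_gt0.
have [G [g gP]] := scalar_net d0.
pose ok (f : {ffun I -> G}) := \sum_i modulus (g (f i)) ^+ 2 <= 1.
exists {ffun I -> G}, (fun f i => if ok f then g (f i) else 0); split=> [f|b b1].
  have [//|_] := boolP (ok f).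
  by rewrite big1 ?ler01// => i _; rewrite modulus0 expr0n.
have [h hP] := choice (fun i => gP _ (modulus_coord_le1 i b1)).
exists [ffun i => h i].
have -> : ok [ffun i => h i].
  rewrite /ok (le_trans _ b1)// ler_sum// => i _; rewrite ffunE.
  by rewrite lerXn2r ?nnegrE ?modulus_ge0//; case: (hP i).
apply: (@le_trans _ _ (\sum_(i : I) d ^+ 2)).
  apply: ler_sum => i _; rewrite ffunE lerXn2r ?nnegrE ?modulus_ge0 ?(ltW d0)//.
  by case: (hP i).
rewrite sumr_const -mulr_natl /d exprMn mulrCA ler_piMr ?sqr_ge0//.
rewrite exprVn ler_pdivrMr ?exprn_gt0// mul1r -natrX ler_nat.
by rewrite (leq_trans (leqnSn _))// leq_pmull.
Qed.

(** If [s] is the supremum of a linear functional over the ball, the net point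
    next to [b] gives [|c . b| <= M + e * s], because the difference is [e]
    times a point of the ball; taking the supremum yields [s <= M + e * s]. *)
Lemma ball_net_norming (I J : finType) (a : J -> I -> K) (e : R) (c : I -> K)
    (M : R) : 0 < e -> ball_net a e ->
  (forall j, modulus (\sum_i c i * a j i) <= M) ->
  forall b, \sum_i modulus (b i) ^+ 2 <= 1 ->
    (1 - e) * modulus (\sum_i c i * b i) <= M.
Proof.
move=> e0 [_ aP] cM.
pose A := [set modulus (\sum_i c i * b i) | b in
            [set b : I -> K | \sum_i modulus (b i) ^+ 2 <= 1]].
have Aub : has_ubound A.
  exists (\sum_i modulus (c i)) => _ [b b1 <-].
  rewrite (le_trans (modulus_sum _ _ _))// ler_sum// => i _.
  by rewrite modulusM ler_piMr ?modulus_ge0// modulus_coord_le1.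
have Ab b : \sum_i modulus (b i) ^+ 2 <= 1 ->
    modulus (\sum_i c i * b i) <= M + e * sup A.
  move=> b1; have [j jP] := aP _ b1.
  have -> : \sum_i c i * b i = \sum_i c i * a j i +
      scalar_of F e * \sum_i c i * (scalar_of F e^-1 * (b i - a j i)).
    rewrite mulr_sumr -big_split; apply: eq_bigr => i _ /=.
    rewrite [c i * (_ * _)]mulrCA [scalar_of F e * _]mulrA -scalar_ofM.
    by rewrite divff ?gt_eqF// scalar_of1 mul1r mulrBr addrC subrK.
  rewrite (le_trans (modulusD _ _))// lerD// modulusM modulus_of ?(ltW e0)//.
  rewrite ler_pM2l//; apply: ub_le_sup => //.
  exists (fun i => scalar_of F e^-1 * (b i - a j i)) => //=.
  under eq_bigr do rewrite modulusM modulus_of ?invr_ge0 ?(ltW e0)// exprMn.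
  by rewrite -mulr_sumr exprVn mulrC ler_pdivrMr ?exprn_gt0// mul1r.
move=> b b1; have bA := ub_le_sup Aub (ex_intro2 _ _ b b1 erefl).
have supA : sup A <= M + e * sup A.
  by apply: ge_sup => [|_ [b' b'1 <-]]; [eexists; exists b|exact: Ab].
have [e1|e1] := lerP (1 - e) 0; last by nra.
have M0 : 0 <= M.
  have [j _] := aP _ b1; exact: le_trans (modulus_ge0 _) (cM j).
by have := modulus_ge0 (\sum_i c i * b i); nra.
Qed.

End Nets.

(** * Injective norms of tensors in a finite-dimensional subspace *)

Section TensorPowers.
Variables (R : realType) (F : scalar_kind).
Local Notation K := (scalars R F).

Lemma pure_tensorP (X Y : lmodType K) (x : X) (y : Y) :
  elem_tensor x y \in @is_tensor K X Y.
Proof. by apply/asboolP; exists [:: (x, y)]; rewrite big_seq1. Qed.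

Definition pure_tensor (X Y : lmodType K) (x : X) (y : Y) : tensor X Y :=
  Tensor (pure_tensorP x y).

(** Indices of the monomials of a tensor power, nested to the left in the same
    way as [tensor_pow]. *)
Fixpoint pow_index (I : finType) (n : nat) : finType :=
  if n is m.+1 then (pow_index I m * I)%type else I.

Lemma card_pow_index (I : finType) n : #|pow_index I n| = (#|I| ^ n.+1)%N.
Proof. by elim: n => [//|n IH] /=; rewrite card_prod IH -expnSr. Qed.

Fixpoint pow_coef (I J : finType) (a : J -> I -> K) (n : nat) :
    pow_index J n -> pow_index I n -> K :=
  match n with
  | 0 => a
  | m.+1 => fun j i => pow_coef a j.1 i.1 * a j.2 i.2
  end.

Fixpoint pow_tensor (I : finType) (X : lmodType K) (x : I -> X) (n : nat) :
    pow_index I n -> tensor_pow X n :=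
  match n with
  | 0 => x
  | m.+1 => fun i => pure_tensor (pow_tensor x i.1) (x i.2)
  end.

Lemma tensor_pow_map_pow_tensor (I : finType) (X Y : lmodType K)
    (f : {linear X -> Y}) (x : I -> X) n (i : pow_index I n) :
  tensor_pow_map f n (pow_tensor x i) = pow_tensor (f \o x) i.
Proof.
elim: n i => [//|n IH] i /=; apply: tensor_eq => B /=.
by rewrite -IH.
Qed.

Lemma pow_coef_ball (I J : finType) (a : J -> I -> K) n (j : pow_index J n) :
  (forall j, \sum_i modulus (a j i) ^+ 2 <= 1) ->
  \sum_i modulus (pow_coef a j i) ^+ 2 <= 1.
Proof.
move=> a1; elim: n j => [//|n IH] j /=.
under eq_bigr do rewrite modulusM exprMn.
rewrite -(pair_bigA _ (fun i k =>
  modulus (pow_coef a j.1 i) ^+ 2 * modulus (a j.2 k) ^+ 2)) /=.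
under eq_bigr do rewrite -mulr_sumr.
rewrite -mulr_suml mulr_ile1 ?sumr_ge0// => *; exact: sqr_ge0.
Qed.

Lemma tensor_sumE (X Y : lmodType K) (I : finType) (f : I -> tensor X Y) B :
  (\sum_i f i) B = \sum_i f i B.
Proof.
by rewrite (big_morph (fun z : tensor X Y => z B : K) (id1 := 0) (op1 := +%R)).
Qed.

(** Tensors in the span of the [x_i] are tested against products of net points
    only: each tensor factor costs one factor [(1 - e)^-1] by
    [ball_net_norming], applied to the vectors [(f x_i)_i], which lie in the
    Euclidean ball. On the first factor the norm of [X] is estimated by the
    triangle inequality, at the price of a constant independent of [n], which
    disappears in the [n]-th root. *)
Lemma inj_norm_pow_le (X : normedModType K) (I J : finType) (x : I -> X)
    (a : J -> I -> K) (e : R) n (c : pow_index I n -> K) (M : R) :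
  0 < e < 1 -> ball_net a e ->
  (forall f : {scalar X}, dual_ball norm f ->
    \sum_i modulus (f (x i)) ^+ 2 <= 1) ->
  0 <= M -> (forall j, modulus (\sum_i c i * pow_coef a j i) <= M) ->
  inj_norm_pow norm n (\sum_i c i *: pow_tensor x i)
    <= (1 - e)^-1 ^+ n.+1 * (\sum_i norm (x i)) * M.
Proof.
move=> /andP[e0 e1] aP xP; have q0 : 0 < 1 - e by rewrite subr_gt0.
have B0 : 0 <= \sum_i norm (x i) by rewrite sumr_ge0// => *; exact: norm_ge0.
elim: n c M => [|n IH] c M M0 cM.
  rewrite /=.
  rewrite (le_trans (norm_sum _ _))// expr1 -mulrA mulrCA mulr_suml ler_sum//= => i _.
  rewrite normZ mulrC ler_wpM2l ?norm_ge0// mulrC ler_pdivlMr// mulrC.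
  (* The coordinate [c i] is the value of the functional [c] at a basis
     vector. *)
  pose b k : K := (k == i)%:R.
  have := ball_net_norming e0 aP cM (b := b).
  rewrite (bigD1 i)//= big1 ?addr0 => [|k /negPf ki]; last first.
    by rewrite /b ki modulus0 expr0n.
  rewrite /b eqxx -(scalar_of1 R F) modulus_of// expr1n lexx => /(_ isT).
  rewrite (bigD1 i)//= big1 ?addr0 => [|k /negPf ki]; last by rewrite ki mulr0.
  by rewrite ?eqxx scalar_of1 mulr1.
apply: inj_norm_le => [|al be hal hbe].
  by rewrite mulr_ge0// mulr_ge0// exprn_ge0// invr_ge0 ltW.
pose d p := \sum_i c (p, i) * be (x i).
have -> : (\sum_i c i *: pow_tensor x (n := n.+1) i : tensor _ _)
      (tensor_dual al be) =
    al (\sum_p d p *: pow_tensor x p).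
  rewrite tensor_sumE linear_sum /=.
  under [RHS]eq_bigr do rewrite linearZ_LR /= /d mulr_suml.
  by rewrite pair_bigA; apply: eq_bigr => -[p i] _ /=; rewrite [RHS]mulrAC -mulrA.
rewrite (le_trans (hal _))// exprSr -!mulrA [_^-1 * _]mulrCA !mulrA.
rewrite -[leRHS]mulrA IH// => [|j]; first by rewrite mulr_ge0// invr_ge0 ltW.
rewrite mulrC ler_pdivlMr// mulrC.
have -> : \sum_p d p * pow_coef a j p =
    \sum_i (\sum_p c (p, i) * pow_coef a j p) * be (x i).
  under eq_bigr do rewrite mulr_suml.
  rewrite exchange_big; apply: eq_bigr => i _ /=; rewrite mulr_suml.
  by apply: eq_bigr => p _; rewrite mulrAC.
apply: (ball_net_norming e0 aP) => [j'|]; last exact: xP.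
have := cM (j, j').
have -> : \sum_i c i * pow_coef a (n := n.+1) (j, j') i =
    \sum_p \sum_i c (p, i) * (pow_coef a j p * a j' i).
  by rewrite pair_bigA; apply: eq_bigr => -[p i].
rewrite exchange_big /=; congr (modulus _ <= _); apply: eq_bigr => i _.
by rewrite mulr_suml; apply: eq_bigr => p _; rewrite mulrA.
Qed.

Lemma pow_tensor_norms (I : finType) (U : lmodType K)
    (d : {dot U for scalar_conj R F}) (h : I -> U) n :
  \sum_i dot_norm (tensor_pow_dot d n) (pow_tensor h i) ^+ 2 =
  (\sum_i dot_norm d (h i) ^+ 2) ^+ n.+1.
Proof.
elim: n => [//|n IH]; rewrite exprSr -IH /= mulr_suml.
under [RHS]eq_bigr do rewrite mulr_sumr.
rewrite pair_bigA /=; apply: eq_bigr => -[p i] _ /=.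
rewrite [LHS]sqr_dot_norm /=.
have zE (B : bilform _ _) : pure_tensor (pow_tensor h p) (h i) B =
   \sum_(q <- [:: (pow_tensor h p, h i)]) B q.1 q.2 by rewrite big_seq1.
rewrite [X in scalar_re X](tensor_dotE (tensor_pow_dot d n) d zE zE) !big_seq1 /=.
by rewrite !dot_normE -scalar_ofM scalar_ofK.
Qed.

End TensorPowers.

(** * Random signs *)

Section RandomSigns.
Variables (R : realType).

(** From [expR (- s) >= 1 - s], each exponential is at most [(1 - s)^-1], and
    the two fractions add up to [2 / (1 - t ^+ 2)]. *)
Lemma cosh_le (t : R) : `|t| <= 2^-1 ->
  expR t + expR (- t) <= 2 * expR (2 * t ^+ 2).
Proof.
rewrite ler_norml => /andP[t1 t2].
have t4 : t ^+ 2 <= 4^-1 by rewrite expr2; nra.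
have inv (s : R) : s < 1 -> expR s <= (1 - s)^-1.
  move=> s1; rewrite -[expR s]invrK -expRN lef_pV2 ?posrE ?subr_gt0 ?expR_gt0//.
  exact: expR_ge1Dx.
apply: (@le_trans _ _ (2 * (1 + 2 * t ^+ 2))); last first.
  by rewrite ler_pM2l// expR_ge1Dx.
apply: (@le_trans _ _ ((1 - t)^-1 + (1 + t)^-1)).
  by rewrite lerD ?inv//; [lra | rewrite (le_trans (inv _ _)) ?opprK//; lra].
have -> : (1 - t)^-1 + (1 + t)^-1 = 2 * (1 - t ^+ 2)^-1.
  by field; rewrite !gt_eqF//; nra.
by rewrite ler_pM2l// -[leLHS]mul1r ler_pdivrMr; nra.
Qed.

Definition sgn (b : bool) : R := (-1) ^+ b.

(** Independence: the exponential moment of a signed sum is a product of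
    hyperbolic cosines. *)
Lemma expR_signs_sum (I : finType) (t : I -> R) : \sum_i t i ^+ 2 <= 4^-1 ->
  \sum_(s : {ffun I -> bool}) expR (\sum_i sgn (s i) * t i) <= 2 ^+ #|I| * 2.
Proof.
move=> t4.
have ti i : `|t i| <= 2^-1.
  rewrite -(@ler_pXn2r _ 2)// ?nnegrE// real_normK ?num_real//.
  rewrite (_ : 2^-1 ^+ 2 = 4^-1); last by field.
  by rewrite (le_trans _ t4)// (bigD1 i)//= lerDl sumr_ge0// => *; rewrite sqr_ge0.
under eq_bigr do rewrite expR_sum.
rewrite -(bigA_distr_bigA (fun i b => expR (sgn b * t i))) /=.
apply: (@le_trans _ _ (\prod_(i : I) (2 * expR (2 * t i ^+ 2)))).
  apply: ler_prod => i _; rewrite sumr_ge0 => [|b _]; last exact: expR_ge0.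
  by rewrite big_bool /sgn /= expr1 expr0 mul1r mulN1r addrC cosh_le.
rewrite big_split /= prodr_const ler_pM2l ?exprn_gt0//.
rewrite -expR_sum -mulr_sumr -[leRHS]invrK.
rewrite (@le_trans _ _ (expR (2^-1)))//.
  by rewrite ler_expR; move: t4; lra.
rewrite -[leLHS]invrK -expRN lef_pV2 ?posrE ?invr_gt0 ?expR_gt0//.
by rewrite (le_trans _ (expR_ge1Dx _))//; lra.
Qed.

End RandomSigns.

Section RandomTensor.
Variables (R : realType) (F : scalar_kind).
Local Notation K := (scalars R F).
Variables (U : lmodType K) (d : {dot U for scalar_conj R F}).
Variables (I : finType).

Definition sign_sum (h : I -> U) (s : {ffun I -> bool}) : U :=
  \sum_i scalar_of F (sgn R (s i)) *: h i.

Lemma dot_norm_sumE (h : I -> U) (c : I -> R) :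
  dot_norm d (\sum_i scalar_of F (c i) *: h i) ^+ 2 =
  \sum_i \sum_j c i * c j * scalar_re (d (h i) (h j)).
Proof.
rewrite sqr_dot_norm linear_sumlz scalar_re_sum; apply: eq_bigr => i _.
rewrite linear_sumr scalar_re_sum; apply: eq_bigr => j _.
by rewrite linearZl_LR linearZr_LR /= conj_scalar_of !scalar_reZ mulrA.
Qed.

(** Flipping the [i]-th sign changes the sign of every summand. *)
Lemma signs_orthogonal (i j : I) : i != j ->
  \sum_(s : {ffun I -> bool}) sgn R (s i) * sgn R (s j) = 0.
Proof.
move=> ij; pose flip (s : {ffun I -> bool}) := [ffun k => s k (+) (k == i)].
have flipK : involutive flip by move=> s; apply/ffunP => k; rewrite !ffunE addbK.
set S := LHS; have : S = - S.
  rewrite {1}/S (reindex_inj (inv_inj flipK)) /= -sumrN; apply: eq_bigr => s _.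
  by rewrite !ffunE eqxx eq_sym (negPf ij) addbF addbT /sgn signrN mulNr.
by move=> /eqP; rewrite -addr_eq0 -mulr2n mulrn_eq0 => /orP[|/eqP].
Qed.

Lemma sum_dot_norm_sign_sum (h : I -> U) :
  \sum_s dot_norm d (sign_sum h s) ^+ 2 =
  2 ^+ #|I| * \sum_i dot_norm d (h i) ^+ 2.
Proof.
under eq_bigr do rewrite dot_norm_sumE.
rewrite exchange_big mulr_sumr; apply: eq_bigr => i _ /=.
rewrite exchange_big (bigD1 i)//= [X in _ + X]big1 ?addr0 => [|j ji].
  under eq_bigr do rewrite -expr2 sqrr_sign mul1r -sqr_dot_norm.
  by rewrite sumr_const card_ffun card_bool -natrX mulr_natl.
by rewrite -mulr_suml signs_orthogonal ?mul0r// eq_sym.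
Qed.

(** The Cauchy-Schwarz bound, from [2 Re <v, w> <= |v|^2 + |w|^2]. *)
Lemma dot_norm_sign_sum_le (h : I -> U) s :
  dot_norm d (sign_sum h s) ^+ 2 <= #|I|%:R * \sum_i dot_norm d (h i) ^+ 2.
Proof.
pose v i := scalar_of F (sgn R (s i)) *: h i.
have vv i : scalar_re (d (v i) (v i)) = dot_norm d (h i) ^+ 2.
  rewrite /v linearZl_LR linearZr_LR /= conj_scalar_of !scalar_reZ mulrA.
  by rewrite -expr2 sqrr_sign mul1r -sqr_dot_norm.
have vw i j : scalar_re (d (v i) (v j)) <=
    2^-1 * (dot_norm d (h i) ^+ 2 + dot_norm d (h j) ^+ 2).
  have := scalar_re_le (dot_ge0 d (v i - v j)).
  rewrite scalar_re0 linearBl !linearBr /= !scalar_reD.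
  have reN (a : K) : scalar_re (- a) = - scalar_re a.
    by apply/eqP; rewrite -addr_eq0 -scalar_reD addNr scalar_re0.
  by rewrite !(reN, scalar_reD) [d (v j) (v i)]dotC re_conj !vv; lra.
rewrite sqr_dot_norm /sign_sum linear_sumlz scalar_re_sum.
apply: (@le_trans _ _ (\sum_i \sum_j 2^-1 *
    (dot_norm d (h i) ^+ 2 + dot_norm d (h j) ^+ 2))).
  apply: ler_sum => i _; rewrite linear_sumr scalar_re_sum.
  by apply: ler_sum => j _; exact: vw.
under eq_bigr do rewrite -mulr_sumr big_split /= sumr_const.
rewrite -mulr_sumr big_split /= sumr_const sumrMnl.
set A := _ *+ #|_|; rewrite (_ : A = #|I|%:R * \sum_i dot_norm d (h i) ^+ 2).
  by lra.
by rewrite mulr_natl.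
Qed.

Lemma expR_modulus_le (z : K) :
  expR (modulus z / 4) <=
    expR (2^-1 * scalar_re z) + expR (- 2^-1 * scalar_re z) +
    (expR (2^-1 * scalar_im z) + expR (- 2^-1 * scalar_im z)).
Proof.
have half_le (t : R) : expR (`|t| / 2) <= expR (2^-1 * t) + expR (- 2^-1 * t).
  rewrite mulrC mulNr -mulrN; case: (ger0P t) => _.
    by rewrite lerDl expR_ge0.
  by rewrite lerDr expR_ge0.
have zle : modulus z <= `|scalar_re z| + `|scalar_im z|.
  rewrite modulus_le ?addr_ge0// -[X in X + _]real_normK ?num_real//.
  rewrite -[X in _ + X]real_normK ?num_real//.
  by rewrite sqrrD lerD2r lerDl mulrn_wge0// mulr_ge0.
have [reim|imre] := lerP `|scalar_re z| `|scalar_im z|.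
  have h : expR (modulus z / 4) <= expR (`|scalar_im z| / 2).
    by rewrite ler_expR; lra.
  by rewrite (le_trans (le_trans h (half_le _)))// lerDr addr_ge0 ?expR_ge0.
have h : expR (modulus z / 4) <= expR (`|scalar_re z| / 2).
  by rewrite ler_expR; lra.
by rewrite (le_trans (le_trans h (half_le _)))// lerDl addr_ge0 ?expR_ge0.
Qed.

Lemma sum_expR_modulus_signs (a : I -> K) : \sum_i modulus (a i) ^+ 2 <= 1 ->
  \sum_(s : {ffun I -> bool})
    expR (modulus (\sum_i scalar_of F (sgn R (s i)) * a i) / 4) <=
  2 ^+ #|I| * 8.
Proof.
move=> a1.
have half (u : R) (f : K -> R) : u ^+ 2 = 4^-1 ->
    (forall z, f z ^+ 2 <= modulus z ^+ 2) ->
    \sum_(s : {ffun I -> bool}) expR (\sum_i sgn R (s i) * (u * f (a i))) <=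
    2 ^+ #|I| * 2.
  move=> u4 fle; apply: expR_signs_sum.
  under eq_bigr do rewrite exprMn u4.
  rewrite -mulr_sumr ler_piMr ?invr_ge0//.
  by rewrite (le_trans _ a1)// ler_sum.
have re_le (z : K) : scalar_re z ^+ 2 <= modulus z ^+ 2.
  by rewrite modulus_sqr lerDl sqr_ge0.
have im_le (z : K) : scalar_im z ^+ 2 <= modulus z ^+ 2.
  by rewrite modulus_sqr lerDr sqr_ge0.
have p4 : 2^-1 ^+ 2 = 4^-1 :> R by field.
have n4 : (- 2^-1) ^+ 2 = 4^-1 :> R by rewrite sqrrN.
have -> : 2 ^+ #|I| * 8 = 2 ^+ #|I| * 2 + 2 ^+ #|I| * 2 +
   (2 ^+ #|I| * 2 + 2 ^+ #|I| * 2) :> R by ring.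
apply: (le_trans _ (lerD (lerD (half _ _ p4 re_le) (half _ _ n4 re_le))
                      (lerD (half _ _ p4 im_le) (half _ _ n4 im_le)))).
rewrite -!big_split /=; apply: ler_sum => s _.
rewrite (le_trans (expR_modulus_le _))// scalar_re_sum scalar_im_sum.
rewrite !mulr_sumr le_eqVlt; apply/orP; left; apply/eqP.
by congr (expR _ + expR _ + (expR _ + expR _)); apply: eq_bigr => i _;
  rewrite ?scalar_reZ ?scalar_imZ mulrCA.
Qed.

Lemma exists_le_of_sum_le (T : finType) (t0 : T) (f g : T -> R) :
  \sum_t f t <= \sum_t g t -> exists t, f t <= g t.
Proof.
move=> fg; apply: contrapT => /forallNP gf.
suff : \sum_t g t < \sum_t f t by rewrite ltNge fg.
apply: ltr_sum => [|t _]; last by rewrite ltNge; apply/negP/gf.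
by apply/hasP; exists t0 => //; rewrite mem_index_enum.
Qed.

(** A choice of signs that keeps the vector [sign_sum h s] almost as long as on
    average while every scalar sum against the [a j] stays of the order of [log
    (#|J| * #|I|)].

    With [X] the squared length, [Y] the sum of the exponentials over [j] and
    [S] the mean of [X], the mean of [16 #|J| X - S Y] is at least [8 #|J| S],
    so some choice reaches this value. As [Y >= 0] this forces [X >= S / 2],
    and as [X <= #|I| S] always, it also forces [Y <= 16 #|J| #|I|]. *)
Lemma exists_signs (J : finType) (a : J -> I -> K) (h : I -> U) :
  (0 < #|J|)%N -> (forall j, \sum_i modulus (a j i) ^+ 2 <= 1) ->
  0 < \sum_i dot_norm d (h i) ^+ 2 ->
  exists s : {ffun I -> bool},
    \sum_i dot_norm d (h i) ^+ 2 <= 2 * dot_norm d (sign_sum h s) ^+ 2 /\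
    forall j, expR (modulus (\sum_i scalar_of F (sgn R (s i)) * a j i) / 4)
      <= (16 * #|J| * #|I|)%:R.
Proof.
move=> J0 aP; move: (\sum_i dot_norm d (h i) ^+ 2) (sum_dot_norm_sign_sum h)
  (dot_norm_sign_sum_le h) => S sumX Xle S0.
pose Y (s : {ffun I -> bool}) := \sum_j
  expR (modulus (\sum_i scalar_of F (sgn R (s i)) * a j i) / 4).
have sumY : \sum_(s : {ffun I -> bool}) Y s <= 2 ^+ #|I| * 8 * #|J|%:R.
  rewrite exchange_big mulr_natr -sumr_const; apply: ler_sum => j _ /=.
  exact: sum_expR_modulus_signs.
have Yj (s : {ffun I -> bool}) j :
    expR (modulus (\sum_i scalar_of F (sgn R (s i)) * a j i) / 4) <= Y s.
  by rewrite /Y (bigD1 j)//= lerDl sumr_ge0// => *; rewrite expR_ge0.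
have Y0 (s : {ffun I -> bool}) : 0 <= Y s.
  by apply: sumr_ge0 => j _; rewrite expR_ge0.
have J0' : 0 < #|J|%:R :> R by rewrite ltr0n.
move: Y sumY Yj Y0 => Y sumY Yj Y0.
have [|s sP] := @exists_le_of_sum_le {ffun I -> bool} [ffun=> false]
    (fun=> 8 * #|J|%:R * S)
    (fun s => 16 * #|J|%:R * dot_norm d (sign_sum h s) ^+ 2 - S * Y s).
  rewrite sumrB -!mulr_sumr sumX sumr_const card_ffun card_bool.
  rewrite -[S *+ _]mulr_natl natrX.
  have := ler_wpM2l (ltW S0) sumY; move: (\sum_s Y s) (2 ^+ #|I|) => SY c.
  by move: #|J|%:R => j; lra.
exists s; have := Y0 s; have := Xle s; move: (dot_norm d _ ^+ 2) sP => W sP WI Ys.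
have SY := mulr_ge0 (ltW S0) Ys; split.
  by rewrite -(ler_pM2l J0'); move: #|J|%:R sP => j; lra.
move=> j; rewrite (le_trans (Yj s j))// !natrM.
rewrite -(ler_pM2l S0); have := ler_wpM2l (ltW J0') WI.
have := mulr_ge0 (ltW J0') (ltW S0).
by move: #|J|%:R #|I|%:R sP => nj ni; lra.
Qed.

End RandomTensor.

(** * Growth and convergence *)

Section Growth.
Variable R : realType.

(** Bernoulli's inequality for a square root of [sigma / v], then squared,
    gives a quadratic lower bound for [(sigma / v) ^+ n], which beats the
    linear factor. *)
Lemma linear_mul_expr_le (w sigma D : R) : 0 <= w < sigma -> 0 <= D ->
  exists N : nat, forall n, (N <= n)%N ->
    D * n.+1%:R * w ^+ n.+1 <= sigma ^+ n.+1.
Proof.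
move=> /andP[w0 ws] D0.
(* [w] may be [0], so the quotients are taken with the midpoint instead. *)
pose v := (w + sigma) / 2.
have v0 : 0 < v by rewrite divr_gt0//; lra.
have vs : v < sigma by rewrite /v; lra.
have wv : w <= v by rewrite /v; lra.
pose q := Num.sqrt (sigma / v).
have qq : q ^+ 2 = sigma / v.
  by rewrite sqr_sqrtr// divr_ge0// ltW// (le_lt_trans w0).
have q1 : 1 < q.
  have sv : 0 < sigma / v by rewrite divr_gt0// (lt_trans v0).
  by rewrite -sqrtr1 ltr_sqrt// ltr_pdivlMr// mul1r.
have bern k : k%:R * (q - 1) <= q ^+ k.
  elim: k => [|k IH]; first by rewrite mul0r.
  have : 1 <= q ^+ k by rewrite exprn_ege1// ltW.
  by rewrite exprS -natr1; nra.
exists (Num.truncn (D / (q - 1) ^+ 2)) => n Nn.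
have Dn : D <= n.+1%:R * (q - 1) ^+ 2.
  rewrite -ler_pdivrMr ?exprn_gt0 ?subr_gt0// ltW//.
  by rewrite (lt_le_trans (truncnS_gt _))// ler_nat.
have n0 : 0 <= n.+1%:R :> R by [].
apply: (@le_trans _ _ (D * n.+1%:R * v ^+ n.+1)).
  by rewrite ler_wpM2l ?mulr_ge0// lerXn2r ?nnegrE// ltW.
have -> : sigma = q ^+ 2 * v by rewrite qq divfK// gt_eqF.
rewrite [leRHS]exprMn ler_pM2r ?exprn_gt0// -exprM mulnC exprM.
apply: (@le_trans _ _ ((n.+1%:R * (q - 1)) ^+ 2)).
  by rewrite exprMn [n.+1%:R ^+ 2]expr2 -mulrA [leLHS]mulrC ler_wpM2l.
rewrite lerXn2r ?nnegrE ?mulr_ge0 ?exprn_ge0 ?subr_ge0 ?(ltW q1)// ltW//.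
by rewrite (lt_trans _ q1).
Qed.

Lemma cvge_from_below (u : nat -> \bar R) (P : \bar R) : (0 <= P)%E ->
  (forall n, u n <= P)%E ->
  (forall r : R, (r%:E < P)%E ->
    exists N, forall n, (N <= n)%N -> (r%:E <= u n)%E) ->
  u @ \oo --> P.
Proof.
case: P => [p| |]// _ uP Pu; last first.
  by apply/cvgeyPge => A; have [|N NP] := Pu A; [exact: ltry|exists N].
move=> A /= /nbhs_EFin/nbhs_ballP[e /= e0 eA].
have [|N NP] := Pu (p - e / 2); first by rewrite lte_fin; lra.
exists N => // n /= Nn; rewrite /=; have := NP n Nn; have := uP n.
case: (u n) => [v| |]//; rewrite !lee_fin => vp pv.
by apply: (eA v); rewrite /ball /= ger0_norm; lra.
Qed.

Lemma poweR_root (a : R) n : 0 <= a -> poweR (a ^+ n.+1)%:E n.+1%:R^-1 = a%:E.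
Proof.
move=> a0; rewrite poweR_EFin -powR_mulrn// -powRrM mulfV ?pnatr_eq0//.
by rewrite powRr1.
Qed.

Lemma le_poweR (x y : \bar R) (r : R) : 0 <= r -> (0 <= x)%E -> (x <= y)%E ->
  (poweR x r <= poweR y r)%E.
Proof.
move=> r0 x0 xy; apply: gt0_ler_poweR => //;
  by rewrite in_itv /= leey ?andbT// (le_trans x0).
Qed.

End Growth.

(** * Random tensors attain the 2-summing norm asymptotically *)

Section LowerBound.
Variables (R : realType) (F : scalar_kind).
Local Notation K := (scalars R F).
Variables (X H : normedModType K) (dotH : {dot H for scalar_conj R F}).
Hypothesis normH : forall x : H, `|x| ^+ 2 = dotH x x.
Variable (phi : {linear X -> H}).

Local Notation op n :=
  (op_norm (inj_norm_pow norm n) (dot_norm (tensor_pow_dot dotH n))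
     (tensor_pow_map phi n)).

Lemma dot_normZ (U : lmodType K) (d : {dot U for scalar_conj R F}) (t : R)
    (u : U) :
  0 <= t -> dot_norm d (scalar_of F t *: u) = t * dot_norm d u.
Proof.
move=> t0; apply: (pexpIrn (n := 2)) => //;
  rewrite ?nnegrE ?mulr_ge0 ?dot_norm_ge0//.
rewrite exprMn !sqr_dot_norm linearZl_LR linearZr_LR /= conj_scalar_of.
by rewrite !scalar_reZ mulrA.
Qed.

Lemma op_norm_tensor_pow_ge0 n : (0 <= op n)%E.
Proof.
have N0 : inj_norm_pow norm n (0 : tensor_pow X n) <= 1.
  case: n => [|n]; first by rewrite /= /norm normr0 scalar_re0.
  apply: (@le_trans _ _ 0) => //; apply: inj_norm_le => // a b _ _.
  by rewrite -[X in X <= _]/(modulus (0 : K)) modulus0.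
apply: (@le_trans _ _
  (dot_norm (tensor_pow_dot dotH n) (tensor_pow_map phi n 0))%:E).
  by rewrite lee_fin dot_norm_ge0.
by apply: ereal_sup_ubound; exists 0.
Qed.

(** The test tensor is a signed sum of all the monomials [x_i1 (x) ... (x)
    x_ik]. Its image has squared norm [S ^+ k] on average over the signs, since
    the signs make the monomials orthogonal in mean. A product of [k] points of
    an [e]-net is one of [#|J| ^ k] coefficient families of Euclidean norm at
    most [1], and a signed sum exceeds a multiple of [k] against one of them
    with a probability smaller than [#|J| ^ - k]; so the injective norm of the
    tensor can be kept below a multiple of [k * (1 - e) ^- k]. The ratio is
    [((1 - e) * sqrt S) ^+ k] up to a factor linear in [k], and [e] is chosen
    so that [(1 - e) * sqrt S > r]. *)
Lemma op_norm_tensor_pow_ge (I : finType) (x : I -> X) (r : R) :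
  (forall f : {scalar X}, dual_ball norm f ->
    \sum_i modulus (f (x i)) ^+ 2 <= 1) ->
  0 <= r -> r ^+ 2 < \sum_i norm (phi (x i)) ^+ 2 ->
  exists N : nat, forall n, (N <= n)%N -> ((r ^+ n.+1)%:E <= op n)%E.
Proof.
move=> xP r0; set S := \sum_i _ => rS.
pose sigma := Num.sqrt S.
have S0 : 0 < S by rewrite (le_lt_trans _ rS)// sqr_ge0.
have s0 : 0 < sigma by rewrite sqrtr_gt0.
have ss : sigma ^+ 2 = S by rewrite sqr_sqrtr// ltW.
have rs : r < sigma by rewrite -(@ltr_pXn2r _ 2) ?nnegrE ?ss// ltW.
pose e := (sigma - r) / (2 * sigma).
have es : (1 - e) * sigma = (sigma + r) / 2 by rewrite /e; field; rewrite gt_eqF.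
have e0 : 0 < e by rewrite divr_gt0 ?subr_gt0// mulr_gt0.
have e1 : 0 < 1 - e by rewrite -(pmulr_lgt0 _ s0) es; lra.
pose q := (1 - e)^-1.
have q0 : 0 < q by rewrite invr_gt0.
have qs : r * q < sigma by rewrite ltr_pdivrMr// mulrC es; lra.
have [J [a aP]] := ball_net_exists F I e0.
have J0 : (0 < #|J|)%N.
  have [|j _] := aP.2 (fun=> 0); last by apply/card_gt0P; exists j.
  by rewrite big1 ?ler01// => i _; rewrite modulus0 expr0n.
pose L : R := (16 * #|J| * #|I|).+1%:R.
have L0 : 0 < L by rewrite ltr0n.
pose B : R := \sum_i norm (x i) + 1.
have B0 : 0 < B by rewrite ltr_wpDl// sumr_ge0// => *; exact: norm_ge0.
have [||N NP] := @linear_mul_expr_le R (r * q) sigma (2 * B * (4 * L)).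
- by rewrite qs mulr_ge0// ltW.
- by rewrite !mulr_ge0// ltW.
exists N => n Nn.
pose h := pow_tensor (phi \o x) (n := n).
pose d := tensor_pow_dot dotH n.
have hS : \sum_i dot_norm d (h i) ^+ 2 = S ^+ n.+1.
  rewrite pow_tensor_norms; congr (_ ^+ _); apply: eq_bigr => i _.
  by rewrite (dot_norm_norm normH).
have [|||s [sS sE]] := @exists_signs R F _ d _ _ (pow_coef a (n := n)) h.
- by rewrite card_pow_index expn_gt0 J0.
- by move=> j; apply: pow_coef_ball; exact: aP.1.
- by rewrite hS exprn_gt0.
rewrite hS in sS.
pose M : R := 4 * L * n.+1%:R.
have M0 : 0 < M by rewrite !mulr_gt0.
have sM j : modulus (\sum_i scalar_of F (sgn R (s i)) * pow_coef a j i) <= M.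
  have := sE j; set m := modulus _ => mE.
  suff : m / 4 <= L * n.+1%:R by rewrite /M; lra.
  rewrite -ler_expR (le_trans mE)// mulrC expRM_natl.
  apply: (@le_trans _ _ (L ^+ n.+1)); last first.
    rewrite lerXn2r ?nnegrE ?expR_ge0 ?(ltW L0)//.
    by rewrite (le_trans _ (expR_ge1Dx _))// lerDr.
  rewrite !card_pow_index /L -natrX ler_nat -mulnA -expnMn.
  apply: (@leq_trans ((16 * #|J| * #|I|) ^ n.+1)); last by rewrite leq_exp2r.
  by rewrite -mulnA [leqRHS]expnMn leq_mul// expnS leq_pmulr// expn_gt0.
(* [t] normalizes the injective norm of the test tensor. *)
pose t := (q ^+ n.+1 * B * M)^-1.
have t0 : 0 < t by rewrite invr_gt0 !mulr_gt0// exprn_gt0.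
pose z := \sum_i (scalar_of F t * scalar_of F (sgn R (s i))) *: pow_tensor x i.
have zle : inj_norm_pow norm n z <= 1.
  rewrite (le_trans (inj_norm_pow_le (M := t * M) (e := e) _ aP xP _ _))//.
  - by rewrite e0 -subr_gt0.
  - by rewrite mulr_ge0// ltW.
  - move=> j; under eq_bigr do rewrite -mulrA.
    by rewrite -mulr_sumr modulusM modulus_of ?ler_pM2l// ltW.
  rewrite mulrCA -/q ler_pdivrMl ?mulr_gt0 ?exprn_gt0// mulr1.
  by rewrite ler_pM2r// ler_pM2l ?exprn_gt0// lerDl.
have -> : (r ^+ n.+1 = t * (q ^+ n.+1 * B * M * r ^+ n.+1))%R.
  by rewrite mulrA mulVf ?mul1r// gt_eqF// !mulr_gt0// exprn_gt0.
apply: (@le_trans _ _ (dot_norm d (tensor_pow_map phi n z))%:E); last first.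
  by apply: ereal_sup_ubound; exists z.
have -> : tensor_pow_map phi n z = scalar_of F t *: sign_sum h s.
  rewrite linear_sum scaler_sumr; apply: eq_bigr => i _.
  by rewrite linearZ /= tensor_pow_map_pow_tensor scalerA.
rewrite lee_fin dot_normZ ?(ltW t0)// ler_pM2l//.
apply: (@le_trans _ _ (sigma ^+ n.+1 / 2)).
  rewrite ler_pdivlMr//; apply: le_trans (NP n Nn); rewrite exprMn /M.
  by rewrite le_eqVlt; apply/orP; left; apply/eqP; ring.
rewrite -(@ler_pXn2r _ 2) ?nnegrE ?dot_norm_ge0 ?divr_ge0 ?exprn_ge0 ?(ltW s0)//.
rewrite exprMn -exprM mulnC exprM ss.
have := exprn_ge0 n.+1 (ltW S0); rewrite -/d; move: sS; rewrite exprVn; lra.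
Qed.

(** A family violating the 2-summing inequality, rescaled so that its weak
    2-norm is at most [1]. The weak 2-norm [sup A] may be [0], so the rescaling
    uses a slightly larger [w]. *)
Lemma not_summing2_bound (r : R) : 0 <= r -> ~ summing2_bound phi r ->
  exists (I : finType) (x : I -> X),
    (forall f : {scalar X}, dual_ball norm f ->
      \sum_i modulus (f (x i)) ^+ 2 <= 1) /\
    r ^+ 2 < \sum_i norm (phi (x i)) ^+ 2.
Proof.
move=> r0 nsum.
have [s] : exists s : seq X, ~ (Num.sqrt (\sum_(x <- s) norm (phi x) ^+ 2) <=
    r * sup [set Num.sqrt (\sum_(x <- s) modulus (f x) ^+ 2) |
             f in dual_ball (@norm R F X)]).
  by apply/existsNP => hs; apply: nsum.
move=> /negP; rewrite -ltNge; set A := [set _ | _ in _].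
set T := \sum_(x <- s) _ => rA.
have T0 : 0 <= T by apply: sumr_ge0 => *; exact: sqr_ge0.
have supA (f : {scalar X}) : dual_ball norm f ->
    Num.sqrt (\sum_(x <- s) modulus (f x) ^+ 2) <= sup A.
  move=> fb; apply: ub_le_sup; last by exists f.
  exists (Num.sqrt (\sum_(x <- s) norm x ^+ 2)) => _ [g gb <-].
  rewrite ler_wsqrtr// ler_sum// => y _.
  by rewrite lerXn2r ?nnegrE ?modulus_ge0 ?norm_ge0.
have A0 : 0 <= sup A.
  apply: (le_trans (sqrtr_ge0 _) (supA (\0 : {scalar X}) _)) => y.
  by rewrite /= modulus0 norm_ge0.
pose w := sup A + (Num.sqrt T - r * sup A) / (r + 1).
have w0 : 0 < w by rewrite ltr_wpDl// divr_gt0 ?subr_gt0// ltr_wpDl.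
have rw : r * w < Num.sqrt T.
  have -> : r * w = Num.sqrt T - (Num.sqrt T - r * sup A) / (r + 1).
    by rewrite /w; field; rewrite gt_eqF// ltr_wpDl.
  by rewrite ltrBlDr ltrDl divr_gt0 ?subr_gt0// ltr_wpDl.
exists 'I_(size s), (fun i => scalar_of F w^-1 *: tnth (in_tuple s) i).
have w10 : 0 <= w^-1 by rewrite invr_ge0 ltW.
split=> [f fb|].
  under eq_bigr do rewrite linearZ_LR modulusM modulus_of// exprMn.
  rewrite -mulr_sumr -(big_tnth _ _ s xpredT (fun x => modulus (f x) ^+ 2)).
  rewrite exprVn ler_pdivrMl ?exprn_gt0// mulr1.
  have Tf : 0 <= \sum_(x <- s) modulus (f x) ^+ 2.
    by apply: sumr_ge0 => *; exact: sqr_ge0.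
  rewrite -(sqr_sqrtr Tf) lerXn2r ?nnegrE ?sqrtr_ge0 ?(ltW w0)//.
  by rewrite (le_trans (supA f fb))// lerDl divr_ge0 ?subr_ge0 ?(ltW rA)// addr_ge0.
under eq_bigr do rewrite linearZ normZ modulus_of// exprMn.
rewrite -mulr_sumr -(big_tnth _ _ s xpredT (fun x => norm (phi x) ^+ 2)) -/T.
rewrite exprVn ltr_pdivlMl ?exprn_gt0// -exprMn mulrC -(sqr_sqrtr T0).
by rewrite ltrXn2r ?nnegrE ?sqrtr_ge0 ?mulr_ge0 ?(ltW w0).
Qed.

End LowerBound.

(** * The limit formula *)

Theorem theorem4p3 (R : realType) (F : scalar_kind)
    (X H : completeNormedModType (scalars R F))
    (dotH : {dot H for scalar_conj R F})
    (normH : forall x : H, `|x| ^+ 2 = dotH x x)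
    (phi : {linear X -> H}) (phi_bounded : bounded_operator phi) :
  let u := fun n : nat =>
    poweR (op_norm (inj_norm_pow norm n)
                   (dot_norm (tensor_pow_dot dotH n))
                   (tensor_pow_map phi n))
          (n.+1%:R^-1) in
  (u @ \oo --> pi2 phi) /\
  (lim (u @ \oo) \is a fin_num <-> two_summing phi).
Proof.
move=> u.
have pi0 : (0 <= pi2 phi)%E.
  by apply: le_ereal_inf_tmp => _ [C [C0 _] <-]; rewrite lee_fin.
have uP : u @ \oo --> pi2 phi.
  apply: cvge_from_below => // [n|r rP].
    apply: le_ereal_inf_tmp => _ [C CP <-]; have C0 := CP.1.
    rewrite -(poweR_root n C0); apply: le_poweR.
    - by rewrite invr_ge0.
    - exact: op_norm_tensor_pow_ge0.
    - exact: op_norm_tensor_pow_le.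
  have [r0|r0] := lerP 0 r; last first.
    exists 0%N => n _; apply: (@le_trans _ _ 0%E); first by rewrite lee_fin ltW.
    exact: poweR_ge0.
  have [|I [x [xP xr]]] := @not_summing2_bound R F X H phi r r0.
    by move=> rsum; move: rP; rewrite ltNge ereal_inf_lbound//; exists r.
  have [N NP] := op_norm_tensor_pow_ge normH xP r0 xr.
  exists N => n Nn; rewrite -(poweR_root n r0); apply: le_poweR.
  - by rewrite invr_ge0.
  - by rewrite lee_fin exprn_ge0.
  - exact: NP.
split=> //; rewrite (cvg_lim _ uP)//; split=> [fin|[C CP]].
  apply: contrapT => none; move: fin.
  rewrite /pi2 (_ : [set _ | _ in _] = set0) ?ereal_inf0//.
  by apply/seteqP; split=> // y [C CP _]; apply: none; exists C.
rewrite ge0_fin_numE// (le_lt_trans _ (ltry C))//.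
by apply: ereal_inf_lbound; exists C.
Qed.
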